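(* Let $1\le k\le N$ be integers. Any biclique cover of the conflict graph of SOS$k(N)$ must have depth at least $\min\{k,N-k\}$.
   Context: SOS$k(N)$ is given by the ground set $J=\{1,\ldots,N\}$ and the family $\mathscr{S}=\{\{\tau,\tau+1,\ldots,\tau+k-1\}:1\le\tau\le N-k+1\}$. A set $T\subseteq J$ is infeasible if it is contained in no $S\in\mathscr{S}$. The conflict graph is $(J,\bar E)$ with $\bar E$ the set of infeasible two-element subsets of $J$. A biclique cover of depth $t$ of a graph $(J,E)$ is a family $\{(A^j,B^j)\}_{j=1}^t$ with $\emptyset\subsetneq A^j,B^j\subsetneq J$, $A^j\cap B^j=\emptyset$, and $\bigcup_{j=1}^t A^j*B^j=E$, where $A*B=\{\{a,b\}:a\in A,\ b\in B\}$. *)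

(* Defs.v *)
From mathcomp Require Import all_boot.
Set Implicit Arguments.
Unset Strict Implicit.
Unset Printing Implicit Defensive.

(* A graph on the vertex type J is given by its edge set, a set of
   two-element subsets of J. *)
Section ConflictGraph.
Variable J : finType.
Implicit Types (SS : {set {set J}}) (T A B : {set J}) (E : {set {set J}}).

Definition infeasible SS T : bool := ~~ [exists S in SS, T \subset S].

Definition conflict_graph SS : {set {set J}} :=
  [set e : {set J} | (#|e| == 2) && infeasible SS e].

Definition biclique A B : {set {set J}} :=
  [set [set a; b] | a in A, b in B].

Definition biclique_cover E (t : nat) (A B : 'I_t -> {set J}) : Prop :=
  (forall j, [/\ set0 \proper A j, A j \proper setT,
                 set0 \proper B j, B j \proper setT
               & A j :&: B j = set0]) /\
  \bigcup_(j < t) biclique (A j) (B j) = E.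

End ConflictGraph.

(* The ground set {1, ..., N} is 'I_N shifted down by one, so the windows
   {tau, ..., tau + k - 1}, 1 <= tau <= N - k + 1, start here at
   0 <= tau <= N - k. The subtraction is truncated: k <= N is intended. *)
Definition SOS (k N : nat) : {set {set 'I_N}} :=
  [set [set j : 'I_N | tau <= j < tau + k] | tau : 'I_(N - k).+1].

(* Main.v *)
Require Import Defs.
From mathcomp Require Import all_boot.
From mathcomp Require Import zify.

(* With [m = min k (N - k)], the edges [{i, i + k}] for [i < m] form a fooling
   set: if [i < j < m] and one biclique contained both [{i, i + k}] and
   [{j, j + k}], it would also contain [{j, i + k}] or [{i, j}], whose vertices
   are at distance less than [k] and hence not in conflict. *)

(** Two points share a window exactly when they are less than [k] apart. If [i = j], both sides are
    false, the right one because [k >= 1]. *)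
Lemma in_conflict_SOS {k N : nat} (i j : 'I_N) : 1 <= k -> k <= N ->
  ([set i; j] \in conflict_graph (SOS k N)) = (i + k <= j) || (j + k <= i).
Proof.
move=> k_ge1 k_le_N; rewrite inE cards2 /infeasible.
have -> : [exists S in SOS k N, [set i; j] \subset S]
          = ~~ ((i + k <= j) || (j + k <= i)).
  apply/existsP/idP => [[S /andP[/imsetP[tau _ ->]]]|close].
    by rewrite subUset !sub1set !inE; lia.
  (* The window starts at the smaller point, or at the last admissible start [N - k] if it would
     otherwise run past the end. *)
  have tauP : minn (minn i j) (N - k) < (N - k).+1 by lia.
  exists [set l : 'I_N | Ordinal tauP <= l < Ordinal tauP + k].
  rewrite imset_f //= subUset !sub1set !inE /=.
  by have := ltn_ord i; have := ltn_ord j; lia.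
by rewrite negbK; case: (eqVneq i j) => [->|_] //=; lia.
Qed.

Lemma in_biclique {J : finType} {A B : {set J}} {i j : J} :
  ([set i; j] \in biclique A B)
  = (i \in A) && (j \in B) || (j \in A) && (i \in B).
Proof.
apply/imset2P/idP => [[a b aA bB eq_ij]|].
  have : (i \in [set a; b]) && (j \in [set a; b]) by rewrite -eq_ij !inE !eqxx orbT.
  have : (a \in [set i; j]) && (b \in [set i; j]) by rewrite eq_ij !inE !eqxx orbT.
  rewrite !inE => /andP[/orP[]/eqP ea /orP[]/eqP eb] /andP[/orP[]/eqP ei /orP[]/eqP ej];
    by subst; rewrite ?aA ?bB ?orbT.
case/orP=> /andP[]; first by move=> iA jB; exists i j.
by move=> jA iB; exists j i; rewrite // setUC.
Qed.

Theorem proposition6 (k N : nat) (k_ge1 : 1 <= k) (k_le_N : k <= N)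
    (t : nat) (A B : 'I_t -> {set 'I_N})
    (coverAB : biclique_cover (conflict_graph (SOS k N)) A B) :
  minn k (N - k) <= t.
Proof.
case: coverAB => _ coverE; set m := minn k (N - k).
have lowP (i : 'I_m) : i < N by have := ltn_ord i; lia.
(* [m <= N - k] keeps [i + k] in the ground set; [m <= k] will make any two indices differ by less
   than [k]. *)
have highP (i : 'I_m) : i + k < N by have := ltn_ord i; lia.
pose lo i := Ordinal (lowP i); pose hi i := Ordinal (highP i).
have covered (i : 'I_m) :
    exists l, [set lo i; hi i] \in biclique (A l) (B l).
  have : [set lo i; hi i] \in conflict_graph (SOS k N).
    by rewrite in_conflict_SOS //= leqnn.
  by rewrite -coverE => /bigcupP[l _ ?]; exists l.
have conflict l x y : x \in A l -> y \in B l -> (x + k <= y) || (y + k <= x).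
  move=> xA yB; rewrite -in_conflict_SOS // -coverE.
  by apply/bigcupP; exists l => //; rewrite in_biclique xA yB.
pose f i := xchoose (covered i).
have f_inj : injective f.
  move=> i j eq_f; apply/val_inj => /=.
  have := xchooseP (covered i); have := xchooseP (covered j).
  rewrite -/(f i) -/(f j) -eq_f !in_biclique.
  have := ltn_ord i; have := ltn_ord j.
  (* Each of the two edges has two orientations. Equal orientations give the cross pairs
     [{lo i, hi j}] and [{lo j, hi i}]; if [i] and [j] differ, the pair joining the larger [lo] to
     the smaller [hi] is too close. Opposite orientations give [{lo i, lo j}] and [{hi i, hi j}],
     both too close. *)
  move=> ltj lti /orP[]/andP[j1 j2] /orP[]/andP[i1 i2];
    have := conflict _ _ _ j1 i2; have := conflict _ _ _ i1 j2; rewrite /=; lia.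
by have := leq_card f f_inj; rewrite !card_ord.
Qed.
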